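(* Let $\tau^*$ be a topology on $\mathscr{C}_{\mathbb{Z}}^{0,0}$ such that: (i) a point $(a,b)$ is isolated in $(\mathscr{C}_{\mathbb{Z}}^{0,0},\tau^* )$ if and only if $a>0$ or $b>0$; (ii) for all integers $a,b$ with $ab=0$ and $a+b\leqslant 0$, the set $A_{(a,b)}=\{(a-i,b-i)\colon i\in\mathbb{N}_0\}$ is an open-and-closed subset of $(\mathscr{C}_{\mathbb{Z}}^{0,0},\tau^* )$ and is a Hausdorff space in the subspace topology. Then $(\mathscr{C}_{\mathbb{Z}}^{0,0},\tau^* )$ is a topological semigroup.
   Context: $\mathbb{N}_0$ is the set of non-negative integers. The extended bicyclic semigroup $\mathscr{C}_{\mathbb{Z}}$ is the set $\mathbb{Z}\times\mathbb{Z}$ with the associative operation $(a,b)\cdot(c,d)=(a-b+c,d)$ if $b<c$; $(a,d)$ if $b=c$; $(a,d+b-c)$ if $b>c$. The variant $\mathscr{C}_{\mathbb{Z}}^{0,0}$ is the set $\mathbb{Z}\times\mathbb{Z}$ with the semigroup operation $(a,b)\ast_{0,0}(c,d)=(a,b)\cdot(0,0)\cdot(c,d)$. A topological semigroup is a topological space with a (jointly) continuous semigroup operation. *)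

(* Defs.v *)
From HB Require Import structures.
From mathcomp Require Import all_boot all_order all_algebra.
From mathcomp Require Import all_classical topology.

Set Implicit Arguments.
Unset Strict Implicit.
Unset Printing Implicit Defensive.

Import Order.TTheory GRing.Theory Num.Theory.

Local Open Scope classical_set_scope.
Local Open Scope ring_scope.

Definition ext_bicyclic_mul (x y : int * int) : int * int :=
  let: (a, b) := x in
  let: (c, d) := y in
  if b < c then (a - b + c, d)
  else if b == c then (a, d)
  else (a, d + b - c).

Definition variant_mul (S : Type) (mul : S -> S -> S) (s x y : S) : S :=
  mul (mul x s) y.

Definition CZ00_mul : int * int -> int * int -> int * int :=
  variant_mul ext_bicyclic_mul (0, 0).

Definition diagonal_ray (a b : int) : set (int * int) :=
  [set (a - i%:Z, b - i%:Z) | i in [set: nat]].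

(* [isOpenTopological] packs a family of open sets containing the whole space
   and closed under binary intersections and arbitrary unions (hence also
   containing the empty set, as an empty union). *)
Definition topology_on (T : choiceType) : Type :=
  isOpenTopological.axioms_ T (Choice.class T) (Choice.class T).

Definition with_topology (T : choiceType) (tau : topology_on T) : Type := T.

HB.instance Definition _ (T : choiceType) (tau : topology_on T) :=
  Choice.on (with_topology tau).
HB.instance Definition _ (T : choiceType) (tau : topology_on T) :
  isOpenTopological (with_topology tau) := tau.

Lemma open_with_topology (T : choiceType) (tau : topology_on T) :
  @open (with_topology tau) = isOpenTopological.op tau.
Proof.
rewrite openE; apply/seteqP; split=> A.
- move=> oA.
  have -> : A = \bigcup_(B : {B : set T | isOpenTopological.op tau B /\ B `<=` A})
                  sval B.
    apply/seteqP; split=> [x /oA [B [oB Bx BA]]|x [[B [oB BA]] _ /BA//]].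
    by exists (exist _ B (conj oB BA)).
  by apply: isOpenTopological.op_bigU => -[B []].
- by move=> oA x Ax; exists A; split.
Qed.

Definition topological_semigroup (T : topologicalType) (mul : T -> T -> T) :=
  associative mul /\ continuous (fun z : T * T => mul z.1 z.2).

(* Main.v *)
(** Let [e = (0, 0)], so that [x * y = (x . e) . y = x . (e . y)] in the variant.
    The map [x |-> x . e] collapses every diagonal ray lying in the quadrant
    [a, b <= 0] to one point; these rays are open and every point outside the
    quadrant is isolated, so the map is locally constant. Dually for
    [y |-> e . y]. Hence the operation is locally constant. *)
Require Import Defs.
From mathcomp Require Import all_boot all_order all_algebra.
From mathcomp Require Import all_classical topology.
From mathcomp Require Import zify.

Import Order.TTheory GRing.Theory Num.Theory.

Local Open Scope classical_set_scope.
Local Open Scope ring_scope.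

(** With [Num.max] the three cases merge into one formula, which [lia] can handle. *)
Lemma ext_bicyclic_mulE (a b c d : int) :
  ext_bicyclic_mul (a, b) (c, d)
  = (a - b + Num.max b c, d - c + Num.max b c).
Proof. by rewrite /ext_bicyclic_mul; case: ltgtP => ?; congr pair; lia. Qed.

Lemma ext_bicyclic_mulA : associative ext_bicyclic_mul.
Proof.
by move=> [a b] [c d] [e f]; rewrite !ext_bicyclic_mulE; congr pair; lia.
Qed.

Lemma variant_mulA (S : Type) (mul : S -> S -> S) (s : S) :
  associative mul -> associative (variant_mul mul s).
Proof. by move=> mulA x y z; rewrite /variant_mul !mulA. Qed.

(** On the product of the two neighbourhoods the operation is constant: replace [mul x' s] by
    [mul x s], reassociate, then replace [mul s y'] by [mul s y]. *)
Lemma variant_mul_continuous (T : topologicalType) (mul : T -> T -> T) (s : T) :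
  associative mul ->
  (forall x, \forall x' \near x, mul x' s = mul x s) ->
  (forall y, \forall y' \near y, mul s y' = mul s y) ->
  continuous (fun z : T * T => variant_mul mul s z.1 z.2).
Proof.
move=> mulA lcl lcr [x y]; apply: cvg_near_cst.
exists ([set x' | mul x' s = mul x s], [set y' | mul s y' = mul s y]).
  by split; [exact: lcl|exact: lcr].
by move=> [x' y'] [/= ex ey]; rewrite /variant_mul ex -!mulA ey.
Qed.

(** Second coordinates on the ray stay nonpositive, so the maximum with 0 is 0 and only the
    difference of coordinates, constant along the ray, survives. *)
Lemma ext_bicyclic_mul_ray_r (a b : int) (x : int * int) :
  b <= 0 -> diagonal_ray a b x -> ext_bicyclic_mul x (0, 0) = (a - b, 0).
Proof.
by move=> b0 [i _ <-]; rewrite ext_bicyclic_mulE; congr pair; lia.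
Qed.

Lemma ext_bicyclic_mul_ray_l (a b : int) (x : int * int) :
  a <= 0 -> diagonal_ray a b x -> ext_bicyclic_mul (0, 0) x = (0, b - a).
Proof.
by move=> a0 [i _ <-]; rewrite ext_bicyclic_mulE; congr pair; lia.
Qed.

(** Moving up the diagonal by [- Num.max a b] steps reaches the boundary of the quadrant. *)
Lemma mem_diagonal_ray_corner (a b : int) : a <= 0 -> b <= 0 ->
  diagonal_ray (a - Num.max a b) (b - Num.max a b) (a, b).
Proof.
by move=> a0 b0; exists `|Num.max a b|%N => //; congr pair; lia.
Qed.

Theorem proposition3p7 (tau : topology_on (int * int)%type)
  (isolated_iff : forall a b : int,
     isolated [set: with_topology tau] (a, b) <-> 0 < a \/ 0 < b)
  (clopen_hausdorff : forall a b : int, a * b = 0 -> a + b <= 0 ->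
     clopen (diagonal_ray a b : set (with_topology tau)) /\
     hausdorff_space (set_type (diagonal_ray a b : set (with_topology tau)))) :
  topological_semigroup (CZ00_mul : with_topology tau -> with_topology tau -> with_topology tau).
Proof.
pose T : topologicalType := with_topology tau.
(* Local criterion serving both factors: [x] is either isolated or on an open ray in the
   quadrant. *)
have locP (x : T) (P : T -> Prop) : P x ->
    (forall a b : int, a <= 0 -> b <= 0 ->
      diagonal_ray a b x -> diagonal_ray a b `<=` P) ->
    \forall x' \near x, P x'.
  case: x => a b Px rayP.
  have [ab_gt0|ab_le0] := pselect (0 < a \/ 0 < b).
    have /isolated_iff [_ [V nbhsV VE]] := ab_gt0.
    rewrite setIT in VE; rewrite VE in nbhsV.
    by apply: filterS nbhsV => _ ->.
  have [a0 b0] : a <= 0 /\ b <= 0 by lia.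
  have ray_ab := mem_diagonal_ray_corner a b a0 b0.
  have [||[oA _] _] := clopen_hausdorff (a - Num.max a b) (b - Num.max a b).
  (* The larger coordinate becomes 0 at the apex, so the product vanishes. *)
  - have [le_ab|le_ba] := leP a b.
      by rewrite subrr mulr0.
    by rewrite subrr mul0r.
  - by lia.
  apply: (filterS (rayP _ _ _ _ ray_ab)); [lia|lia|].
  exact: open_nbhs_nbhs.
split; first exact/variant_mulA/ext_bicyclic_mulA.
apply: (variant_mul_continuous T ext_bicyclic_mul (0, 0) ext_bicyclic_mulA) => x;
  apply: locP => // a b a0 b0 ray_x x' ray_x'.
  by rewrite !(ext_bicyclic_mul_ray_r a b).
by rewrite !(ext_bicyclic_mul_ray_l a b).
Qed.
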